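(* There exists a permutation $a_1, a_2, a_3, \ldots$ of the positive integers (that is, a sequence in which every positive integer occurs exactly once) containing no subsequence of the form $$a,\ a+r,\ a+2r,\ a+3r,$$ where $r$ is a nonzero integer. Equivalently, there are no indices $i<j<k<l$ and no nonzero integer $r$ such that $a_j=a_i+r$, $a_k=a_i+2r$ and $a_l=a_i+3r$.
   Context: A permutation of the positive integers is an infinite sequence $a_1,a_2,a_3,\ldots$ indexed by the positive integers, given by a bijection $i\mapsto a_i$ from the positive integers to themselves. The common difference $r$ may be positive or negative. *)

(* Defs.v *)
From mathcomp Require Import all_boot all_order all_algebra.

Set Implicit Arguments.
Unset Strict Implicit.
Unset Printing Implicit Defensive.

Import GRing.Theory.
Local Open Scope ring_scope.

Definition posint : Type := {n : nat | (0 < n)%N}.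

(* Entries are compared in [int], so that the common difference may be
   negative. *)
Definition has_4AP (a : posint -> posint) : Prop :=
  exists (i j k l : posint) (r : int),
    [/\ (val i < val j)%N, (val j < val k)%N & (val k < val l)%N] /\
    r != 0 /\
    [/\ (val (a j))%:Z = (val (a i))%:Z + r,
        (val (a k))%:Z = (val (a i))%:Z + 2 * r
      & (val (a l))%:Z = (val (a i))%:Z + 3 * r].

(* Main.v *)
Require Import Defs.
From mathcomp Require Import all_boot all_order all_algebra.
From mathcomp Require Import zify.

Set Implicit Arguments.
Unset Strict Implicit.
Unset Printing Implicit Defensive.

(** The permutation enumerates the natural numbers (shifted by one) in the order
    of an injective function [key], which compares first stages, then bits.

    A rapidly growing sequence of depths k_0 < k_1 < ... is fixed.  By the end of
    stage i exactly the numbers x < [extent i x] have been placed, where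
    [extent i x] depends only on the last k_i bits of x.  These sets are finite
    and increasing; all numbers of stages before i are below 2^k_i, while every
    extent at stage i is at least 3 * 2^k_i.  Inside stage i, two numbers are
    compared at the lowest bit v where they differ: bit 1 comes first if v < k_i,
    and bit 0 comes first if v >= k_i.  The extents follow this order: if two
    numbers first differ at a bit v < k_i, the one with bit 1, whose class comes
    first, has an extent at least three times as large
    ([extent_separated]).

    Let p1, p2, p3, p4 be an arithmetic progression in order of placement, and
    let v be the 2-adic valuation of its difference.  Consecutive terms agree
    below bit v and differ at bit v, so that bit v alternates along the
    progression.  Hence three consecutive terms never lie in the same stage
    ([key_no_3AP_in_stage]), and two cases remain.

    - p3 belongs to a stage i and p4 to a later one
      ([no_4AP_last_two_apart]).  Then p1 belongs to an earlier stage, so it is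
      below 2^k_i, and the progression increases to p4, beyond its extent.
      Suppose v < k_i.  If p4 had bit 1, its extent would be at least three times
      that of p3, hence more than p4, which is at most 3/2 of p3.  So p3 has bit
      1 and p2 has bit 0.  A number p2 from an earlier stage would give
      p4 < 3 * 2^k_i, and a number p2 of stage i comes after p3.  Suppose
      v >= k_i.  Bit v of p1 < 2^k_i is 0, so p2 has bit 1 and belongs to stage i,
      where p3, with bit 0, comes before it.
    - p3 and p4 belong to the same stage i, p1 and p2 to earlier ones
      ([no_4AP_last_two_together]).  Since p1 and p2 are below 2^k_i, v < k_i;
      as p3 comes before p4, bit v is 1, 0, 1, 0 along the progression.  Let
      j = i - 1, so that p2 is below its extent at stage j, and p3 is not.  If
      v < k_j, the extent of p3 is at least three times that of p2, so
      p3 > 3 * p2, although p3 <= 2 * p2.  If v >= k_j, bit 1 in p1 forces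
      p1 >= 2^k_j, so p1 and p2 both belong to stage j, where p2, with bit 0,
      comes before p1. *)

(** * Binary digits and arithmetic progressions *)

Definition bit (v x : nat) : bool := odd (x %/ 2 ^ v).

(** [v] is the 2-adic valuation of the difference of [x] and [y]: the paths of [x]
    and [y] in the binary tree of residue classes separate at depth [v]. *)
Definition branch_at (v x y : nat) : Prop :=
  x = y %[mod 2 ^ v] /\ bit v x = ~~ bit v y.

(** The number with binary digits [b 0 ... b (n - 1)], [b 0] the most significant:
    it turns comparison at the first differing digit into [<]. *)
Fixpoint rev_value (n : nat) (b : nat -> bool) : nat :=
  if n is m.+1 then 2 * rev_value m b + b m else 0.

Lemma eq_rev_value n b c :
  (forall w, w < n -> b w = c w) -> rev_value n b = rev_value n c.
Proof.
elim: n => //= n IH bc; rewrite bc // IH // => w wn.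
by apply: bc; apply: ltnW.
Qed.

Lemma rev_value_lt n b : rev_value n b < 2 ^ n.
Proof. by elim: n => //= n IH; rewrite expnS; case: (b n); lia. Qed.

Lemma rev_value_lex n v b c : v < n -> (forall w, w < v -> b w = c w) ->
  b v = false -> c v = true -> rev_value n b < rev_value n c.
Proof.
elim: n => //= n IH vn bc bv cv.
have [vltn|nlev] := ltnP v n.
  by have := IH vltn bc bv cv; case: (b n); case: (c n); lia.
have -> : n = v by lia.
by rewrite bv cv (@eq_rev_value v b c) //; lia.
Qed.

Lemma bit_modn w v x : w < v -> bit w (x %% 2 ^ v) = bit w x.
Proof.
move=> wv; rewrite /bit {2}(divn_eq x (2 ^ v)).
have -> : x %/ 2 ^ v * 2 ^ v = (x %/ 2 ^ v * 2 ^ (v - w).-1 * 2) * 2 ^ w.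
  by rewrite -!mulnA -expnS -expnD; congr (_ * 2 ^ _); lia.
by rewrite divnMDl ?expn_gt0 // oddD !oddM andbF.
Qed.

Lemma eq_bit v x y w : x = y %[mod 2 ^ v] -> w < v -> bit w x = bit w y.
Proof. by move=> xy wv; rewrite -(bit_modn x wv) xy bit_modn. Qed.

Lemma bit_small v k x : x < 2 ^ k -> k <= v -> bit v x = false.
Proof.
move=> xk kv; rewrite /bit divn_small //.
by apply: leq_trans xk _; rewrite leq_exp2l.
Qed.

Lemma branch_atC v x y : branch_at v x y -> branch_at v y x.
Proof. by case=> e d; split; [rewrite e | rewrite d negbK]. Qed.

Lemma branch_at_small v k x y :
  branch_at v x y -> x < 2 ^ k -> y < 2 ^ k -> v < k.
Proof.
move=> [_ d] xk yk; rewrite ltnNge; apply/negP => kv.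
by move: d; rewrite !(bit_small (k := k)).
Qed.

Lemma branch_at_addn x r : 0 < r -> branch_at (logn 2 r) x (x + r).
Proof.
move=> r0; have /dvdnP[q rE] := pfactor_dvdnn 2 r.
have oq : odd q.
  have := pfactor_coprime (isT : prime 2) r0.
  case=> m; rewrite coprime2n => om rE'.
  have : q * 2 ^ logn 2 r = m * 2 ^ logn 2 r by rewrite -rE -rE'.
  by move/eqP; rewrite eqn_pmul2r ?expn_gt0 // => /eqP ->.
move: (logn 2 r) rE => v ->; split; first by rewrite addnC modnMDl.
by rewrite /bit addnC divnMDl ?expn_gt0 // oddD oq /= negbK.
Qed.

(** The common difference, of either sign, has a single 2-adic valuation; the
    progression is given by its middle terms so that both signs are treated
    alike. *)
Lemma AP_branch_at p1 p2 p3 p4 :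
  p1 + p3 = 2 * p2 -> p2 + p4 = 2 * p3 -> p1 <> p2 ->
  exists v, [/\ branch_at v p1 p2, branch_at v p2 p3 & branch_at v p3 p4].
Proof.
move=> e1 e2 ne; have [lt12|] := ltnP p1 p2.
  have r0 : 0 < p2 - p1 by lia.
  exists (logn 2 (p2 - p1)).
  have H x y : y = x + (p2 - p1) -> branch_at (logn 2 (p2 - p1)) x y.
    by move=> ->; apply: branch_at_addn.
  by split; apply: H; lia.
move=> le21; have r0 : 0 < p1 - p2 by lia.
exists (logn 2 (p1 - p2)).
have H x y : x = y + (p1 - p2) -> branch_at (logn 2 (p1 - p2)) x y.
  by move=> ->; apply/branch_atC/branch_at_addn.
by split; apply: H; lia.
Qed.

(** * Stages *)

(** The growth is what makes the extents at stage [i] at most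
    [2 ^ depth i.+1]. *)
Fixpoint depth (i : nat) : nat :=
  if i is j.+1 then 2 ^ (depth j).+1 + depth j else 0.

(** At the first bit where two classes modulo [2 ^ depth i] differ, the one with
    bit 1 has the larger reversed value; the power of 3 turns this into a factor
    of at least 3 between the extents. *)
Definition extent (i x : nat) : nat :=
  3 ^ (rev_value (depth i) (bit^~ x)).+1 * 2 ^ depth i.

Lemma depth_ltS i : depth i < depth i.+1.
Proof. by rewrite /= -[X in X < _]add0n ltn_add2r expn_gt0. Qed.

Lemma leq_depth i j : i <= j -> depth i <= depth j.
Proof.
move=> /subnK <-; elim: (j - i) => // n IH.
by apply: leq_trans IH _; rewrite addSn ltnW // depth_ltS.
Qed.

Lemma extent_ge i x : 3 * 2 ^ depth i <= extent i x.
Proof. by rewrite /extent leq_mul2r expnS leq_pmulr ?expn_gt0 ?orbT. Qed.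

Lemma extent_le i x : extent i x <= 2 ^ depth i.+1.
Proof.
have -> : 2 ^ depth i.+1 = 4 ^ 2 ^ depth i * 2 ^ depth i.
  by rewrite /= expnD [2 ^ (depth i).+1]expnS expnM.
(* 3 ^ m <= 4 ^ m for m = 2 ^ depth i, which bounds the reversed value *)
rewrite leq_mul2r; apply/orP; right.
apply: leq_trans (_ : 3 ^ 2 ^ depth i <= _); last by rewrite leq_exp2r // expn_gt0.
by rewrite leq_exp2l // rev_value_lt.
Qed.

Lemma extent_separated i v x y :
  branch_at v x y -> v < depth i -> bit v x = false ->
  3 * extent i x <= extent i y.
Proof.
move=> [xy d] vk bx; rewrite /extent mulnA -expnS leq_mul2r leq_exp2l //.
apply/orP; right; rewrite ltnS; apply: (rev_value_lex vk _ bx).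
  by move=> w; apply: eq_bit.
by move: d; rewrite bx => /esym/negbFE.
Qed.

Lemma extent_mono i j x : i <= j -> x < extent i x -> x < extent j x.
Proof.
rewrite leq_eqVlt => /predU1P[-> //|ij] xi; apply: leq_trans (extent_ge j x).
have := leq_trans xi (extent_le i x).
have : 2 ^ depth i.+1 <= 2 ^ depth j by rewrite leq_exp2l // leq_depth.
lia.
Qed.

Lemma exists_stage x : exists i, x < extent i x.
Proof.
exists x; apply: leq_trans (extent_ge x x).
have : x <= depth x.
  by elim: x => // x IH; apply: leq_ltn_trans IH (depth_ltS x).
by have := ltn_expl (depth x) (isT : 1 < 2); lia.
Qed.

Definition stage (x : nat) : nat := ex_minn (exists_stage x).

Lemma stage_le i x : (stage x <= i) = (x < extent i x).
Proof.
rewrite /stage; case: ex_minnP => j xj jmin; apply/idP/idP; last exact: jmin.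
by move=> ji; apply: extent_mono xj.
Qed.

Lemma stage_lt_pow2 i x : stage x < i -> x < 2 ^ depth i.
Proof.
case: i => // i; rewrite ltnS stage_le => xi.
exact: leq_trans xi (extent_le i x).
Qed.

(** * The order of placement *)

(** The leading power of 2 exceeds the reversed value, so that the keys of
    different stages lie in disjoint dyadic intervals.  Flipping the bits below
    [depth i] makes bit 1 come first there, and bit 0 first above. *)
Definition key (x : nat) : nat :=
  let i := stage x in
  2 ^ depth i.+1 + rev_value (depth i.+1) (fun v => bit v x (+) (v < depth i)).

Lemma leq_key x : x <= key x.
Proof. by have := @stage_lt_pow2 (stage x).+1 x (leqnn _); rewrite /key; lia. Qed.

Lemma key_stage x y : key x <= key y -> stage x <= stage y.
Proof.
move=> xy; rewrite leqNgt; apply/negP => yx.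
have : 2 ^ (depth (stage y).+1).+1 <= 2 ^ depth (stage x).+1.
  by rewrite leq_exp2l //; apply: leq_trans (depth_ltS _) (leq_depth _).
have := rev_value_lt (depth (stage y).+1)
          (fun v => bit v y (+) (v < depth (stage y))).
by move: xy; rewrite /key expnS; lia.
Qed.

Lemma branch_at_neq x y : x <> y -> exists v, branch_at v x y.
Proof.
have [xy|yx|//] := ltngtP x y => _.
  by exists (logn 2 (y - x)); rewrite -{2}(subnKC (ltnW xy));
    apply: branch_at_addn; rewrite subn_gt0.
by exists (logn 2 (x - y)); rewrite -{2}(subnKC (ltnW yx));
  apply/branch_atC/branch_at_addn; rewrite subn_gt0.
Qed.

(** The digit at [v] is the first one that differs in the two reversed values, and
    flipping the bits below [depth] makes the preferred bit of stage [stage x] at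
    depth [v] the digit 0. *)
Lemma key_branch_lt v x y : branch_at v x y -> stage x = stage y ->
  bit v x = (v < depth (stage x)) -> key x < key y.
Proof.
move=> [xy d] sxy bx; rewrite /key -sxy ltn_add2l.
apply: (@rev_value_lex _ v).
- apply: (@branch_at_small v _ x y); first by split.
    exact: stage_lt_pow2.
  by apply: stage_lt_pow2; rewrite sxy.
- by move=> w wv; rewrite (eq_bit xy wv).
- by rewrite bx addbb.
- by move: d; rewrite bx => ->; case: (bit v y).
Qed.

Lemma key_branch v x y : branch_at v x y -> stage x = stage y ->
  key x < key y -> bit v x = (v < depth (stage x)).
Proof.
move=> br sxy kxy; apply/eqP; apply: contraLR kxy => ne.
rewrite -leqNgt ltnW //; apply: key_branch_lt (branch_atC br) _ _ => //.
by move: ne; case: br => _ ->; rewrite sxy; case: (bit v y); case: (_ < _).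
Qed.

Lemma key_inj : injective key.
Proof.
move=> x y kxy; apply/eqP; apply: contraT => /eqP/branch_at_neq[v br].
have sxy : stage x = stage y.
  by apply/eqP; rewrite eqn_leq !key_stage // kxy.
have [bx|bx] := eqVneq (bit v x) (v < depth (stage x)).
  by have := key_branch_lt br sxy bx; rewrite kxy ltnn.
suff : key y < key x by rewrite kxy ltnn.
apply: key_branch_lt (branch_atC br) _ _ => //.
by move: bx; case: br => _ ->; rewrite sxy; case: (bit v y); case: (_ < _).
Qed.

(** The first two of three alternating bits cannot both be the preferred one. *)
Lemma key_no_3AP_in_stage v x y z : branch_at v x y -> branch_at v y z ->
  stage x = stage y -> stage y = stage z -> key x < key y -> key y < key z ->
  False.
Proof.
move=> xy yz sxy syz kxy kyz; case: (xy) => _.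
by rewrite (key_branch xy) // (key_branch yz) // sxy; case: (_ < _).
Qed.

(** The progression increases and [p4] is at most 3/2 of [p3].  If the extent of
    [p4] were three times that of [p3], the stage of [p3] would already contain
    [p4]; otherwise the bit order of this stage places [p3] before [p2]. *)
Lemma no_4AP_last_two_apart p1 p2 p3 p4 v :
  p1 + p3 = 2 * p2 -> p2 + p4 = 2 * p3 ->
  branch_at v p1 p2 -> branch_at v p2 p3 -> branch_at v p3 p4 ->
  key p1 < key p2 -> key p2 < key p3 ->
  stage p1 < stage p3 -> stage p3 < stage p4 -> False.
Proof.
move=> e1 e2 b12 b23 b34 k12 k23 s13 s34; set i := stage p3 in s13 s34.
have p1s : p1 < 2 ^ depth i by apply: stage_lt_pow2.
have p3s : p3 < extent i p3 by rewrite -stage_le.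
have p4s : extent i p4 <= p4 by rewrite leqNgt -stage_le -ltnNge.
have g4 := extent_ge i p4.
have p2s : stage p2 < i \/ stage p2 = i.
  by have := key_stage (ltnW k23); rewrite -/i; lia.
have [vi|iv] := ltnP v (depth i).
  (* with bit 0 in p3, the extent of p4 is more than 3 * p3, hence than p4 *)
  case b3: (bit v p3); last first.
    by have := extent_separated b34 vi b3; lia.
  (* if p2 were below 2 ^ depth i, then p4 < 3 * p2 would be within its extent *)
  case: p2s => [p2s|p2s]; first by have := stage_lt_pow2 p2s; lia.
  have := key_branch b23 p2s k23; rewrite p2s vi => b2.
  by case: b23; rewrite b2 b3.
have b1 := bit_small p1s iv.
case: p2s => [/stage_lt_pow2 p2s|p2s].
  by have := branch_at_small b12 p1s p2s; lia.
have := key_branch b23 p2s k23; rewrite p2s [v < _]ltnNge iv /= => b2.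
by case: b12; rewrite b1 b2.
Qed.

(** The order preferred at stage [i] for bits below [depth i] forces bit 1 in
    [p1] and bit 0 in [p2]; the preceding stage [j] either has already placed
    [p3], or places [p2] before [p1]. *)
Lemma no_4AP_last_two_together p1 p2 p3 p4 v :
  p1 + p3 = 2 * p2 -> p2 + p4 = 2 * p3 ->
  branch_at v p1 p2 -> branch_at v p2 p3 -> branch_at v p3 p4 ->
  key p1 < key p2 -> key p3 < key p4 ->
  stage p2 < stage p3 -> stage p3 = stage p4 -> False.
Proof.
move=> e1 e2 b12 b23 b34 k12 k34 s23 s34.
have s12 := key_stage (ltnW k12).
have b3 := key_branch b34 s34 k34.
have vlt : v < depth (stage p3).
  by apply: branch_at_small b12 _ _; apply: stage_lt_pow2 => //; lia.
rewrite vlt in b3.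
have b2 : bit v p2 = false by case: b23; rewrite b3.
have b1 : bit v p1 by case: b12; rewrite b2.
case i3: (stage p3) s23 => [//|j]; rewrite ltnS => s2j.
have p2s : p2 < extent j p2 by rewrite -stage_le.
have p3s : extent j p3 <= p3 by rewrite leqNgt -stage_le; lia.
have [vj|jv] := ltnP v (depth j).
  (* extent j p3 >= 3 * extent j p2 > 3 * p2, while p3 <= 2 * p2 if the
     progression increases and p3 < p2 if it decreases *)
  by have := extent_separated b23 vj b2; lia.
have jle x : bit v x -> j <= stage x.
  move=> bx; rewrite leqNgt; apply/negP => /stage_lt_pow2 xs.
  by move: bx; rewrite (bit_small xs jv).
have s1 := jle p1 b1.
have s1j : stage p1 = j by lia.
have := key_branch b12 _ k12; rewrite s1j b1 ltnNge jv => H.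
by have : true = ~~ true by apply: H; lia.
Qed.

Lemma key_no_4AP p1 p2 p3 p4 :
  p1 + p3 = 2 * p2 -> p2 + p4 = 2 * p3 ->
  key p1 < key p2 -> key p2 < key p3 -> key p3 < key p4 -> False.
Proof.
move=> e1 e2 k12 k23 k34.
have ne : p1 <> p2 by move=> e; move: k12; rewrite e ltnn.
have [v [b12 b23 b34]] := AP_branch_at e1 e2 ne.
have s12 := key_stage (ltnW k12); have s23 := key_stage (ltnW k23).
have s34 := key_stage (ltnW k34).
have [s34'|s34'] := ltnP (stage p3) (stage p4).
  apply: (no_4AP_last_two_apart e1 e2 b12 b23 b34) => //.
  rewrite ltnNge; apply/negP => s31.
  by apply: (key_no_3AP_in_stage b12 b23) => //; lia.
apply: (no_4AP_last_two_together e1 e2 b12 b23 b34) => //; last by lia.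
rewrite ltnNge; apply/negP => s32.
by apply: (key_no_3AP_in_stage b23 b34) => //; lia.
Qed.

(** * Enumeration in increasing order of an injective function *)

Section Enumeration.

Variable f : nat -> nat.
Hypothesis f_inj : injective f.
Hypothesis f_ge : forall x, x <= f x.

(** The number of predecessors of [x] in the order of [f]: they all lie below
    [f x], because [y <= f y]. *)
Definition rank (x : nat) : nat := \sum_(y < f x) (f y < f x).

Lemma rankE n x : f x <= n -> rank x = \sum_(y < n) (f y < f x).
Proof.
move=> xn; rewrite /rank -!(big_mkord xpredT (fun y => (f y < f x) : nat)).
rewrite (big_cat_nat _ xn) //=.
suff -> : \sum_(f x <= y < n) (f y < f x) = 0 by rewrite addn0.
rewrite big_nat_cond big1 // => y /andP[/andP[xy _] _].
by rewrite ltnNge (leq_trans xy).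
Qed.

Lemma rank_lt x y : (rank x < rank y) = (f x < f y).
Proof.
have mono a b : f a < f b -> rank a < rank b.
  move=> ab; rewrite (rankE (ltnW ab)) /rank.
  have ob : a < f b by apply: leq_ltn_trans ab.
  rewrite (bigD1 (Ordinal ob)) //= [X in _ < X](bigD1 (Ordinal ob)) //= ltnn ab.
  rewrite add0n add1n ltnS; apply: leq_sum => c _.
  by case: (ltnP (f c) (f a)) => // ca; rewrite (ltn_trans ca ab).
apply/idP/idP; last exact: mono.
apply: contraTT; rewrite -!leqNgt leq_eqVlt => /predU1P[/f_inj -> //|/mono].
exact: ltnW.
Qed.

Lemma rank_inj : injective rank.
Proof.
move=> x y e; apply: f_inj; have := rank_lt x y; have := rank_lt y x.
by rewrite e ltnn; lia.
Qed.

(** The predecessor of [x] with the largest value of [f] is its immediate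
    predecessor. *)
Lemma rank_pred x n : rank x = n.+1 -> exists y, rank y = n.
Proof.
move=> xn; have [y0 y0x] : exists y : 'I_(f x), f y < f x.
  apply/existsP; apply: contraTT isT; rewrite negb_exists => /forallP none.
  by move: xn; rewrite /rank big1 // => y _; rewrite (negbTE (none y)).
have [y yx ymax] :=
  @arg_maxnP _ y0 (fun y : 'I_(f x) => f y < f x) (fun y => f y) y0x.
exists y; apply: succn_inj; rewrite -xn (rankE (ltnW yx)) /rank.
rewrite (bigD1 y) //= [RHS](bigD1 y) //= ltnn yx add0n add1n; congr _.+1.
apply: eq_bigr => z zy; congr nat_of_bool; apply/idP/idP => [zlt|zx].
  exact: ltn_trans yx.
rewrite ltn_neqAle; apply/andP; split; last exact: ymax.
by apply: contraNneq zy => /f_inj zy; apply/eqP/val_inj.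
Qed.

Lemma rank_surj n : exists x, rank x == n.
Proof.
have [x nx] : exists x, n <= rank x.
  elim: n => [|n [x nx]]; first by exists 0.
  by exists (f x).+1; apply: leq_ltn_trans nx _; rewrite rank_lt f_ge.
have descend m : forall z, rank z = n + m -> exists y, rank y == n.
  elim: m => [|m IH] z; first by rewrite addn0 => /eqP; exists z.
  by rewrite addnS => /rank_pred[y]; apply: IH.
exact: descend (esym (subnKC nx)).
Qed.

Lemma increasing_enumeration :
  exists s : nat -> nat, bijective s /\ forall i j, i < j -> f (s i) < f (s j).
Proof.
pose s n := xchoose (rank_surj n).
have sK : cancel s rank by move=> n; apply/eqP; exact: (xchooseP (rank_surj n)).
exists s; split; first by exists rank => // x; apply: rank_inj.
by move=> i j ij; rewrite -rank_lt !sK.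
Qed.

End Enumeration.

Theorem mainTheorem1 :
  exists a : posint -> posint, bijective a /\ ~ has_4AP a.
Proof.
have [s [[t sK tK] s_incr]] := increasing_enumeration key_inj leq_key.
pose shift (g : nat -> nat) (i : posint) : posint :=
  exist _ (g (val i).-1).+1 (ltn0Sn _).
have shiftK g h : cancel g h -> cancel (shift g) (shift h).
  by move=> gK [i i0]; apply: val_inj; rewrite /= gK prednK.
exists (shift s); split; first by exists (shift t); apply: shiftK.
move=> [[i i0] [[j j0] [[k k0] [[l l0] [r [[/= ij jk kl] [r0 [ej ek el]]]]]]]].
apply: (@key_no_4AP (s i.-1) (s j.-1) (s k.-1) (s l.-1)); first by lia.
- by lia.
- by apply: s_incr; lia.
- by apply: s_incr; lia.
- by apply: s_incr; lia.
Qed.
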